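(* There exist an absolute constant $\epsilon_0>0$ and a function $\eta:(0,\epsilon_0]\to[0,\infty)$ with $\eta(\epsilon)\to0$ as $\epsilon\to0$ such that for every $0<\epsilon\le\epsilon_0$ there is an integer $d_0(\epsilon)$ such that for every integer $d\ge d_0(\epsilon)$ there exist a finite set $P_\epsilon\subset\mathbb{R}^d$ and a point $s\in P_\epsilon$ such that every $(1+\epsilon,\beta)$-shallow-light tree for $P_\epsilon$ rooted at $s$ (with respect to the Euclidean metric) has $\beta>\left(\frac43-\eta(\epsilon)\right)\frac1\epsilon$.
   Context: For a finite point set $P\subset\mathbb{R}^d$, consider the complete graph on $P$ in which each edge $xy$ has weight $w(x,y)=\|x-y\|_2$. For a graph $H$ on $P$, $w(H)$ is the sum of its edge weights, and $\mathrm{dist}_H$ is the weighted shortest-path distance in $H$. Let $\mathrm{MST}(P)$ be a minimum-weight spanning tree of this complete graph. For $\alpha,\beta\ge 1$ and $s\in P$, an $(\alpha,\beta)$-shallow-light tree (SLT) for $P$ rooted at $s$ is a spanning tree $T$ of the complete graph on $P$ (no Steiner points) such that $\mathrm{dist}_T(s,t)\le\alpha\cdot w(s,t)$ for all $t\in P$, and $w(T)\le\beta\cdot w(\mathrm{MST}(P))$. *)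

(* Defs.v *)
From HB Require Import structures.
From mathcomp Require Import all_boot all_order all_algebra finmap.
From mathcomp Require Import all_classical all_reals all_analysis.

Set Implicit Arguments.
Unset Strict Implicit.
Unset Printing Implicit Defensive.

Import Order.TTheory GRing.Theory Num.Theory.
Import numFieldNormedType.Exports.

Local Open Scope classical_set_scope.
Local Open Scope ring_scope.

(* The norm `|u| that the library puts on row vectors is the sup norm. *)
Definition euclidean_norm (R : realType) (d : nat) (u : 'rV[R]_d) : R :=
  Num.sqrt (\sum_(i < d) u ord0 i ^+ 2).

(* A graph on the vertex set V is its adjacency relation H : rel V. *)
Section WeightedGraph.
Variables (R : realType) (V : finType) (w : V -> V -> R).
Implicit Types (H T M : rel V).

Definition simple_graph H := symmetric H /\ irreflexive H.

Definition connected_graph H := forall x y : V, connect H x y.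

(* A simple closed walk of length 2 runs back and forth along one edge, so
   only those of length at least 3 are cycles. *)
Definition acyclic_graph H :=
  forall c : seq V, ucycle H c -> (size c < 3)%N.

Definition spanning_tree H :=
  [/\ simple_graph H, connected_graph H & acyclic_graph H].

(* Every edge {x, y} contributes both (x, y) and (y, x) to the double sum. *)
Definition graph_weight H : R :=
  2^-1 * \sum_(x : V) \sum_(y : V | H x y) w x y.

Fixpoint path_weight (x : V) (p : seq V) : R :=
  if p is y :: q then w x y + path_weight y q else 0.

(* Extended-real, so that the distance is +oo when no path exists. *)
Definition graph_dist H (x y : V) : \bar R :=
  ereal_inf [set (path_weight x p)%:E | p in
    [set p : seq V | [/\ path H x p, uniq (x :: p) & last x p = y]]].

Definition minimum_spanning_tree M :=
  spanning_tree M /\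
  forall H, spanning_tree H -> graph_weight M <= graph_weight H.

(* All minimum spanning trees have the same weight, and one exists whenever a
   spanning tree does, so the choice of M is immaterial. *)
Definition shallow_light_tree (alpha beta : R) (s : V) T :=
  [/\ 1 <= alpha, 1 <= beta, spanning_tree T,
      forall t : V, (graph_dist T s t <= (alpha * w s t)%:E)%E
    & exists2 M, minimum_spanning_tree M &
        graph_weight T <= beta * graph_weight M].

End WeightedGraph.

Definition euclidean_weight (R : realType) (d : nat) (P : {fset 'rV[R]_d})
    (x y : P) : R :=
  euclidean_norm (val x - val y).

(* Main.v *)
(* Take s = 0, k leaves e_0 + r e_i on k further orthogonal directions, and
   c = b e_0, with r ~ eps / sqrt 2 and b ~ 1 + eps / 4.  Every leaf is at
   distance D ~ 1 from s, but reaching it through c or through another leaf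
   costs more than (1 + eps) D, so the tree contains all k edges from s to the
   leaves.  The star centred at c has weight b + k l with l ~ (3 / 4) eps, and
   the ratio tends to (4 / 3) / eps as k grows. *)
Require Import Defs.
From HB Require Import structures.
From mathcomp Require Import all_boot all_order all_algebra finmap.
From mathcomp Require Import all_classical all_reals all_analysis.
From mathcomp Require Import ring lra.

Set Implicit Arguments.
Unset Strict Implicit.
Unset Printing Implicit Defensive.

Import Order.TTheory GRing.Theory Num.Theory.
Import numFieldNormedType.Exports.

Local Open Scope classical_set_scope.
Local Open Scope ring_scope.

(** * Stars as spanning trees *)

Section Star.
Variables (R : realType) (V : finType) (w : V -> V -> R) (c : V).

Definition star : rel V := fun x y => (x != y) && ((x == c) || (y == c)).

Lemma star_spanning_tree : spanning_tree star.
Proof.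
have star_sym : symmetric star by move=> x y; rewrite /star eq_sym orbC.
split.
- by split=> // x; rewrite /star eqxx.
- have conn_c x : connect star x c.
    have [->|xc] := eqVneq x c; first exact: connect0.
    by apply: connect1; rewrite /star xc eqxx orbT.
  move=> x y; apply: (connect_trans (conn_c x)).
  by rewrite (sym_connect_sym star_sym).
- case=> [|x [|y [|z p]]] //.
  rewrite /ucycle /= => /andP[/and3P[xy yz zp]].
  rewrite !inE !negb_or => /and3P[/and3P[xNy xNz xp] /andP[yNz yp] /andP[zNp _]].
  (* Every edge meets [c], but a cycle visits [c] at most once. So if [x] is [c], the edge [yz]
     misses it; otherwise [y] is [c], and the edge leaving [z] either misses [c] or revisits it. *)
  exfalso; have [xc|xNc] := eqVneq x c.
    move: yz; rewrite /star -xc (eq_sym y x) (eq_sym z x).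
    by rewrite (negPf xNy) (negPf xNz) andbF.
  have yc : y = c by move: xy; rewrite /star (negPf xNc) /= => /andP[_ /eqP].
  case: p zp xp yp zNp => [|u p] /= /andP[zu _] xp yp zNp.
    by move: zu; rewrite /star -yc (negPf xNy) (eq_sym z y) (negPf yNz) andbF.
  move: zu yp; rewrite /star -yc (eq_sym z y) (negPf yNz) /=.
  by case/andP=> _ /eqP->; rewrite inE eqxx.
Qed.

Lemma graph_weight_star : (forall x y, w x y = w y x) ->
  graph_weight w star = \sum_(y | y != c) w c y.
Proof.
move=> w_sym; rewrite /graph_weight (bigD1 c) //=.
rewrite (eq_bigl (fun y => y != c)); last first.
  by move=> y; rewrite /star eqxx eq_sym andbT.
rewrite [X in _ + X](eq_bigr (w c)) => [|x xNc].
  by rewrite -mulr2n -[X in _ * X]mulr_natl mulrA mulVf ?mul1r ?pnatr_eq0.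
rewrite (big_pred1 c) => [|y]; first exact: w_sym.
by rewrite /star (negPf xNc) /=; have [->|_] := eqVneq y c; rewrite ?xNc ?andbF.
Qed.

End Star.

(** * Lower bounds on path lengths and tree weights *)

Section Paths.
Variables (R : realType) (V : finType) (w : V -> V -> R).

Lemma path_weight_rcons x p y :
  path_weight w x (rcons p y) = path_weight w x p + w (last x p) y.
Proof. by elim: p x => [|z p IHp] x /=; rewrite ?addr0 ?add0r // IHp addrA. Qed.

(** Here [h] is a 1-Lipschitz potential and its increments telescope along the path. It is applied
    to [h = w s], so only triangle inequalities based at [s] are ever required. *)
Lemma le_path_weight (h : V -> R) : (forall x y, h y <= h x + w x y) ->
  forall x p, h (last x p) <= h x + path_weight w x p.
Proof.
move=> h_lip x p; elim: p x => [|y p IHp] x /=; first by rewrite addr0.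
by apply: le_trans (IHp y) _; rewrite addrA lerD2r.
Qed.

(** Each edge from [s] to [A] occurs twice in the double sum, in row [s] and in row [x]. As [s] lies
    outside [A], these rows are distinct, which compensates the factor 1/2. *)
Lemma graph_weight_ge_neighbors (T : rel V) (s : V) (A : pred V) :
  (forall x y, 0 <= w x y) -> (forall x y, w x y = w y x) -> symmetric T ->
  (forall x, A x -> T s x) -> ~~ A s ->
  \sum_(x | A x) w s x <= graph_weight w T.
Proof.
move=> w_ge0 w_sym T_sym AT AsN.
rewrite /graph_weight ler_pdivlMl ?ltr0n // mulr_natl mulr2n [leRHS](bigD1 s) //=.
apply: lerD.
  rewrite [leRHS](bigID A) /= -[leLHS]addr0 lerD ?sumr_ge0 //.
  rewrite [leRHS](eq_bigl A) // => x.
  by case: (boolP (A x)) => [/AT->|_]; rewrite ?andbF.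
rewrite [leRHS](bigID A) /= -[leLHS]addr0 lerD //; last first.
  by apply: sumr_ge0 => x _; apply: sumr_ge0.
rewrite [leRHS](eq_bigl A) => [|x]; last first.
  by case: (boolP (A x)) => [Ax|_]; rewrite ?andbF //; apply/andP; split=> //;
    apply: contraNneq AsN => <-.
apply: ler_sum => x Ax; rewrite (bigD1 s) /=; last by rewrite T_sym AT.
by rewrite w_sym lerDl sumr_ge0.
Qed.

End Paths.

(* The gap conditions say that a detour from s to a leaf, through another leaf
   or through c, is too long; hence T joins every leaf to s by an edge. *)
Lemma slt_star_bound (R : realType) (V : finType) (w : V -> V -> R) (s c : V)
    (alpha beta b D l m : R) (T : rel V) :
  (forall x y, 0 <= w x y) -> (forall x y, w x y = w y x) -> s != c ->
  w s s = 0 -> w s c = b ->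
  (forall x, x \notin pred2 s c -> w s x = D) ->
  (forall x, x \notin pred2 s c -> w c x = l) ->
  (forall x y, x \notin pred2 s c -> y \notin pred2 s c -> x != y ->
     w x y = m) ->
  b <= D + l -> alpha * D < D + m -> alpha * D < b + l ->
  shallow_light_tree w alpha beta s T ->
  #|predC (pred2 s c)|%:R * D <= beta * (b + #|predC (pred2 s c)|%:R * l).
Proof.
move=> w_ge0 w_sym sNc wss wsc wsD wcl wm bDl gap_leaf gap_c.
case=> alpha1 beta1 [[T_sym T_irr] _ _] T_dist [M [_ M_min] TM].
have beta0 : 0 <= beta by apply: le_trans beta1.
(* The only cases with content are from a leaf to [c], which is [b <= D + l], and from [c] to a
   leaf, where [D <= alpha * D < b + l]. *)
have w_lip x y : w s y <= w s x + w x y.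
  have [->|xNs] := eqVneq x s; first by rewrite wss add0r.
  have [->|yNs] := eqVneq y s; first by rewrite wss addr_ge0.
  have [->|xNy] := eqVneq x y; first by rewrite lerDl.
  have [yc|yNc] := eqVneq y c.
    have xL : x \notin pred2 s c by rewrite !inE (negPf xNs) -yc (negPf xNy).
    by rewrite yc (w_sym x) wsc wsD ?wcl.
  have yL : y \notin pred2 s c by rewrite !inE (negPf yNs) (negPf yNc).
  have [xc|xNc] := eqVneq x c.
    rewrite xc wsc wsD // wcl //; apply: le_trans (ltW gap_c).
    by rewrite ler_peMl // -(wsD y yL).
  have xL : x \notin pred2 s c by rewrite !inE (negPf xNs) (negPf xNc).
  by rewrite !wsD // lerDl.
have T_leaf x : x \notin pred2 s c -> T s x.
  move=> xL; apply: contraT => sxN.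
  have xNs : x != s by move: xL; rewrite !inE negb_or => /andP[].
  (* Without the edge from [s] to [x], the last vertex [u] before [x] is [c] or another leaf. The
     path then costs at least [w s u + w u x], that is [b + l] or [D + m]. *)
  have : ((Num.min (D + m) (b + l))%:E <= graph_dist w T s x)%E.
    apply: le_ereal_inf_tmp => _ [p [Tp _ px] <-].
    case/lastP: p Tp px => [_ /= sx|p y]; first by rewrite sx eqxx in xNs.
    rewrite last_rcons rcons_path => /andP[_ Tyx] yx; rewrite {}yx in Tyx *.
    rewrite lee_fin path_weight_rcons.
    set u := last s p in Tyx *.
    have su : w s u <= path_weight w s p.
      by have := le_path_weight w_lip s p; rewrite wss add0r.
    have uNs : u != s by apply: contraNneq sxN => <-.
    have uNx : u != x by apply: contraTneq Tyx => ->; rewrite T_irr.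
    apply: le_trans (lerD su (lexx _)).
    have [uc|uNc] := eqVneq u c.
      by rewrite uc wsc wcl // ge_min lexx orbT.
    have uL : u \notin pred2 s c by rewrite !inE (negPf uNs) (negPf uNc).
    by rewrite wsD // wm // ge_min lexx.
  move=> /le_trans/(_ (T_dist x)); rewrite lee_fin wsD // leNgt.
  by rewrite lt_min gap_leaf gap_c.
(* The left side becomes the weight of the edges forced into [T], the right side that of the star at
   [c], a competitor of [M]. *)
have -> : #|predC (pred2 s c)|%:R * D = \sum_(x | predC (pred2 s c) x) w s x.
  by rewrite (eq_bigr (fun=> D)) ?sumr_const ?mulr_natl // => x /wsD.
have -> : b + #|predC (pred2 s c)|%:R * l = graph_weight w (star c).
  rewrite graph_weight_star // (bigD1 s) //= w_sym wsc; congr (_ + _).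
  rewrite (eq_bigl (predC (pred2 s c))) => [|x]; last first.
    by rewrite /= negb_or andbC.
  by rewrite (eq_bigr (fun=> l)) ?sumr_const ?mulr_natl // => x /wcl.
apply: le_trans (le_trans TM _); last first.
  by rewrite ler_wpM2l // M_min //; exact: star_spanning_tree.
by apply: graph_weight_ge_neighbors => //=; rewrite eqxx.
Qed.

(** * Coordinates and numerical parameters of the point set *)

Section Cons.
Variables (R : realType) (k : nat).

Definition cons_rV (a : R) (u : 'I_k -> R) : 'rV[R]_k.+1 :=
  \row_i if unlift ord0 i is Some j then u j else a.

Lemma cons_rVB a a' u u' :
  cons_rV a u - cons_rV a' u' = cons_rV (a - a') (fun j => u j - u' j).
Proof. by apply/rowP => i; rewrite !mxE; case: unliftP. Qed.

Lemma euclidean_norm_cons_rV a u :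
  euclidean_norm (cons_rV a u) = Num.sqrt (a ^+ 2 + \sum_j u j ^+ 2).
Proof.
rewrite /euclidean_norm big_ord_recl mxE unlift_none; congr (Num.sqrt (_ + _)).
by apply: eq_bigr => j _; rewrite mxE liftK.
Qed.

Lemma cons_rV_inj a a' u u' :
  cons_rV a u = cons_rV a' u' -> a = a' /\ u =1 u'.
Proof.
move=> /rowP e; split=> [|j].
  by have := e ord0; rewrite !mxE unlift_none.
by have := e (lift ord0 j); rewrite !mxE liftK.
Qed.

End Cons.

Lemma euclidean_normN (R : realType) d (u : 'rV[R]_d) :
  euclidean_norm (- u) = euclidean_norm u.
Proof.
by congr Num.sqrt; apply: eq_bigr => i _; rewrite mxE sqrrN.
Qed.

(* For D = 1 the two gap conditions of [slt_star_bound] read m = r sqrt 2 > eps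
   and b - 1 + l > eps; to first order they force r = eps / sqrt 2 and
   b - 1 = eps / 4, and then l = (3 / 4) eps.  The terms of order eps ^+ 2 make
   the inequalities strict.  Here q = r ^+ 2. *)
Lemma gap_parameters (R : realType) (eps q b D l m : R) :
  0 < eps <= 1 / 100 ->
  q = (eps * (1 + eps)) ^+ 2 / 2 -> b = 1 + (eps / 4 + eps ^+ 2) ->
  D = Num.sqrt (1 + q) -> l = Num.sqrt ((eps / 4 + eps ^+ 2) ^+ 2 + q) ->
  m = Num.sqrt (2 * q) ->
  [/\ 1 <= D, b <= D + l, (1 + eps) * D < D + m, (1 + eps) * D < b + l
    & l <= 3 / 4 * eps * (1 + 4 * eps)].
Proof.
move=> /andP[e0 e1] qE bE DE lE mE.
have e2 : 0 < eps ^+ 2 by apply: exprn_gt0.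
have e3 : eps ^+ 2 <= eps / 100 by rewrite expr2 ler_pM2l //; lra.
have q0 : 0 <= q by rewrite qE divr_ge0 // sqr_ge0.
have qle : q <= 3 / 4 * eps ^+ 2.
  have : (1 + eps) ^+ 2 <= 3 / 2 by nra.
  by rewrite qE exprMn; nra.
have D1 : 1 <= D by rewrite DE -[leLHS]sqrtr1 ler_wsqrtr // lerDl.
have l0 : 0 <= l by rewrite lE sqrtr_ge0.
have l2 : l ^+ 2 = eps ^+ 2 * ((1 / 4 + eps) ^+ 2 + (1 + eps) ^+ 2 / 2).
  by rewrite lE sqr_sqrtr ?addr_ge0 ?sqr_ge0 // qE; ring.
have {mE} mE : m = eps * (1 + eps).
  rewrite mE qE mulrC divfK ?pnatr_eq0 // sqrtr_sqr ger0_norm //.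
  by rewrite mulr_ge0 // ?addr_ge0 // ltW.
have Dle : D <= 1 + q / 2.
  rewrite -(@ler_pXn2r _ 2) ?nnegrE //; try lra.
  by rewrite DE sqr_sqrtr; nra.
have lge : eps / 4 + eps ^+ 2 <= l.
  by rewrite lE -[leLHS]ger0_norm -?sqrtr_sqr ?ler_wsqrtr ?lerDl //; lra.
(* With [b = 1 + eps / 4 + eps ^+ 2] this yields [b + l > 1 + eps + eps ^+ 2 / 2]. The excess beats
   the error [3 / 8 * eps ^+ 2 * (1 + eps)] that [D] brings into [(1 + eps) * D]. *)
have lgt : 3 / 4 * eps - eps ^+ 2 / 2 < l.
  rewrite -(@ltr_pXn2r _ 2) ?nnegrE //; last nra.
  rewrite l2 (_ : (_ - _) ^+ 2 = eps ^+ 2 * (3 / 4 - eps / 2) ^+ 2); last by field.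
  by rewrite ltr_pM2l //; nra.
have bDl : b <= D + l by lra.
split=> //.
(* Since [m = eps * (1 + eps)], the leaf gap amounts to [D < 1 + eps]. *)
- have : D < 1 + eps by lra.
  by rewrite -(ltr_pM2l e0) mE; lra.
- have : (1 + eps) * D <= (1 + eps) * (1 + 3 / 8 * eps ^+ 2).
    by rewrite ler_wpM2l //; lra.
  by rewrite bE; nra.
- rewrite -(@ler_pXn2r _ 2) ?nnegrE //; last by rewrite !mulr_ge0 //; lra.
  rewrite l2 (_ : (_ * _ * _) ^+ 2 = eps ^+ 2 * (3 / 4 * (1 + 4 * eps)) ^+ 2).
    by rewrite ler_pM2l //; nra.
  by field.
Qed.

(** The crude bounds [1 <= D] and [b <= 2] leave an inequality in [N], [eps] and [beta] alone. *)
Lemma spider_slt_bound (R : realType) (k : nat) (eps : R) :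
  0 < eps <= 1 / 100 ->
  exists (P : {fset 'rV[R]_k.+1}) (s : P), exists2 N : nat, (k <= N)%N &
    forall beta T,
      shallow_light_tree (@euclidean_weight R k.+1 P) (1 + eps) beta s T ->
      N%:R <= beta * (2 + N%:R * (3 / 4 * eps * (1 + 4 * eps))).
Proof.
move=> e01; have /andP[e0 e1] := e01.
pose q := (eps * (1 + eps)) ^+ 2 / 2.
have q0 : 0 < q by rewrite /q; apply: divr_gt0 => //; apply: exprn_gt0; nra.
pose r := Num.sqrt q.
have r2 : r ^+ 2 = q by rewrite sqr_sqrtr // ltW.
have rN0 : r != 0 by rewrite -sqrf_eq0 r2 gt_eqF.
pose b := 1 + (eps / 4 + eps ^+ 2).
have [D1 bDl gap_leaf gap_c lle] :=
  gap_parameters e01 (erefl q) (erefl b) erefl erefl erefl.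
set D := Num.sqrt (1 + q) in D1 bDl gap_leaf gap_c.
set l := Num.sqrt (_ + q) in bDl gap_c lle.
set m := Num.sqrt (2 * q) in gap_leaf.
pose vs : 'rV[R]_k.+1 := cons_rV 0 (fun=> 0).
pose vc : 'rV[R]_k.+1 := cons_rV b (fun=> 0).
pose vl j : 'rV[R]_k.+1 := cons_rV 1 (fun i => r *+ (i == j)).
have sum_leaf (j : 'I_k) : \sum_i (r *+ (i == j)) ^+ 2 = q.
  rewrite (bigD1 j) //= eqxx mulr1n r2 big1 ?addr0 // => i /negPf->.
  by rewrite mulr0n expr0n.
pose P : {fset 'rV[R]_k.+1} :=
  (vs |` (vc |` [fset vl j | j in 'I_k]))%fset.
have sP : vs \in P by rewrite !inE eqxx.
have cP : vc \in P by rewrite !inE eqxx orbT.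
have lP j : vl j \in P.
  by rewrite !in_fsetU !in_fset1; apply/or3P/Or33/imfsetP; exists j.
pose s : P := [` sP]%fset; pose c : P := [` cP]%fset.
pose lf j : P := [` lP j]%fset.
have lf_inj : injective lf.
  move=> i j /(congr1 val) /cons_rV_inj[_ /(_ i)]; rewrite eqxx.
  by case: (i =P j) => // _ /eqP; rewrite mulr1n mulr0n (negPf rN0).
have leafP x : x \notin pred2 s c -> exists j, x = lf j.
  rewrite !inE negb_or => /andP[xs xc]; have := valP x.
  rewrite !in_fsetU !in_fset1 => /or3P[/eqP e|/eqP e|/imfsetP[j _ e]].
  - by case/eqP: xs; apply: val_inj.
  - by case/eqP: xc; apply: val_inj.
  - by exists j; apply: val_inj.
have bgt : 1 < b by rewrite /b; nra.
have sNc : s != c.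
  apply/eqP => /(congr1 val) /cons_rV_inj[b0 _].
  by move: bgt; rewrite -b0 ltr10.
have lfL j : lf j \notin pred2 s c.
  rewrite !inE negb_or; apply/andP; split; apply/eqP.
    by move=> /(congr1 val) /cons_rV_inj[/eqP]; rewrite oner_eq0.
  by move=> /(congr1 val) /cons_rV_inj[b1 _]; move: bgt; rewrite -b1 ltxx.
have w_sym (x y : P) : euclidean_weight x y = euclidean_weight y x :> R.
  by rewrite /euclidean_weight -euclidean_normN opprB.
(* Taking all points other than [s] and [c] avoids an exact leaf count: injectivity of [lf] gives
   [k <= N]. *)
exists P, s, #|predC (pred2 s c)|.
  rewrite -[leqLHS]card_ord -(card_codom lf_inj); apply: subset_leq_card.
  by apply/fintype.subsetP => _ /codomP[j ->]; apply: lfL.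
move=> beta T sltT.
have key : #|predC (pred2 s c)|%:R * D <=
    beta * (b + #|predC (pred2 s c)|%:R * l).
  apply: (slt_star_bound _ w_sym sNc _ _ _ _ _ bDl gap_leaf gap_c sltT).
  - by move=> x y; apply: sqrtr_ge0.
  - rewrite /euclidean_weight subrr /euclidean_norm big1 ?sqrtr0 // => i _.
    by rewrite mxE expr0n.
  - rewrite w_sym /euclidean_weight /= cons_rVB euclidean_norm_cons_rV.
    rewrite big1 => [|i _]; last by rewrite subr0 expr0n.
    by rewrite subr0 addr0 sqrtr_sqr gtr0_norm // (lt_trans ltr01).
  - move=> _ /leafP[j ->].
    rewrite w_sym /euclidean_weight /= cons_rVB euclidean_norm_cons_rV.
    rewrite (eq_bigr (fun i => (r *+ (i == j)) ^+ 2)) => [|i _]; last first.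
      by rewrite subr0.
    by rewrite sum_leaf subr0 expr1n.
  - move=> _ /leafP[j ->].
    rewrite /euclidean_weight /= cons_rVB euclidean_norm_cons_rV.
    rewrite (eq_bigr (fun i => (r *+ (i == j)) ^+ 2)) => [|i _]; last first.
      by rewrite sub0r sqrrN.
    by rewrite sum_leaf /b (addrC 1) addrK.
  - move=> _ _ /leafP[i ->] /leafP[j ->] lij.
    have iNj : i != j by apply: contraNneq lij => ->.
    rewrite /euclidean_weight /= cons_rVB euclidean_norm_cons_rV.
    rewrite subrr expr0n add0r.
    (* The two leaf offsets have disjoint supports, so the squared distance is [q + q]. *)
    rewrite (eq_bigr (fun h => (r *+ (h == i)) ^+ 2 + (r *+ (h == j)) ^+ 2)).
      by rewrite big_split /= !sum_leaf -mulr2n -mulr_natl.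
    move=> h _; have [->|_] := eqVneq h i.
      by rewrite (negPf iNj) /= !mulr0n subr0 expr0n addr0.
    by rewrite mulr0n sub0r sqrrN expr0n add0r.
have beta0 : 0 <= beta by case: sltT => _ /(le_trans ler01).
apply: (le_trans (le_trans _ key)).
  by rewrite ler_peMr.
rewrite ler_wpM2l // lerD //; first by rewrite /b; nra.
by rewrite ler_wpM2l.
Qed.

Theorem theorem1p5 (R : realType) :
  exists (eps0 : R) (eta : R -> R),
    [/\ 0 < eps0,
        forall eps : R, 0 < eps <= eps0 -> 0 <= eta eps,
        eta eps @[eps --> 0^'+] --> (0 : R)
      & forall eps : R, 0 < eps <= eps0 ->
          exists d0 : nat, forall d : nat, (d0 <= d)%N ->
            exists (P : {fset 'rV[R]_d}) (s : P),
              forall (beta : R) (T : rel P),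
                shallow_light_tree (@euclidean_weight R d P)
                  (1 + eps) beta s T ->
                (4 / 3 - eta eps) * (1 / eps) < beta].
Proof.
(* The end of the proof gives [beta * eps >= 4 / 3 / (1 + 5 * eps)], which is at least
   [4 / 3 - 20 / 3 * eps]; 7 exceeds 20/3. *)
exists (1 / 100), (fun eps => 7 * eps); split.
- lra.
- by move=> eps /andP[e0 _]; rewrite mulr_ge0 // ltW.
- apply: cvg_at_right_filter; rewrite -[X in _ --> X](mulr0 7).
  by apply: cvgMr; exact: cvg_id.
move=> eps e01; have /andP[e0 e1] := e01.
(* One successor is the axis coordinate, the other makes [k] exceed [3 / eps ^+ 2]. Absorbing the
   additive 2 by raising [4 * eps] to [5 * eps] needs [eps ^+ 2 * N >= 8 / 3], whence the 3. *)
exists (Num.truncn (3 / eps ^+ 2)).+2 => -[//|k]; rewrite ltnS => kge.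
have [P [s [N kN slt]]] := spider_slt_bound k e01.
exists P, s => beta T /slt; clear slt => NB.
have Nbig : 3 < eps ^+ 2 * N%:R.
  rewrite -ltr_pdivrMl ?exprn_gt0 // mulrC.
  by apply: lt_le_trans (truncnS_gt _) _; rewrite ler_nat (leq_trans kge).
have N0 : 0 < N%:R :> R by nra.
have beta0 : 0 < beta.
  rewrite ltNge; apply/negP => beta0.
  have : 0 <= 2 + N%:R * (3 / 4 * eps * (1 + 4 * eps)) by nra.
  by move=> /(mulr_le0_ge0 beta0); lra.
rewrite mulrA mulr1 ltr_pdivrMr //.
have : 2 + N%:R * (3 / 4 * eps * (1 + 4 * eps)) <=
    N%:R * (3 / 4 * eps * (1 + 5 * eps)) by nra.
move=> /(ler_wpM2l (ltW beta0)) /(le_trans NB).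
rewrite mulrCA -[leLHS]mulr1 ler_pM2l // => h.
have e5 : 0 < 1 + 5 * eps by lra.
rewrite -(ltr_pM2r e5); nra.
Qed.
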